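(* The Paley graph $P(17)$ satisfies $\chi(H)\leq\binom{\omega(H)+1}{2}$ for every induced subgraph $H$ of $P(17)$, but $P(17)$ is not perfectly divisible. Consequently, every graph containing $P(17)$ as an induced subgraph is not perfectly divisible.
   Context: All graphs are finite and simple; $\chi$ denotes chromatic number and $\omega$ denotes clique number. The Paley graph $P(17)$ has vertex set $\mathbb F_{17}$, where two distinct vertices $x,y$ are adjacent if and only if $x-y$ is a nonzero square in $\mathbb F_{17}$. A graph is perfect if every induced subgraph $H$ of it satisfies $\chi(H)=\omega(H)$. A graph $G$ is perfectly divisible if, for every induced subgraph $H$ of $G$ with at least one edge, $V(H)$ can be partitioned into sets $A$ and $B$ (possibly empty) such that $H[A]$ is perfect and $\omega(H[B])<\omega(H)$. *)

(* Defs.v *)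
From mathcomp Require Import all_boot all_order all_algebra.

Set Implicit Arguments.
Unset Strict Implicit.
Unset Printing Implicit Defensive.

Import GRing.Theory.

Record sgraph := SGraph {
  vertex :> finType;
  adj : rel vertex;
  adj_sym : symmetric adj;
  adj_irrefl : irreflexive adj }.

Section InducedSubgraph.
Variables (G : sgraph) (S : {set G}).

Definition induced_adj : rel {x : G | x \in S} :=
  fun x y => adj (val x) (val y).

Lemma induced_adj_sym : symmetric induced_adj.
Proof. by move=> x y; apply: adj_sym. Qed.

Lemma induced_adj_irrefl : irreflexive induced_adj.
Proof. by move=> x; apply: adj_irrefl. Qed.

Definition induced : sgraph := SGraph induced_adj_sym induced_adj_irrefl.
End InducedSubgraph.

Definition isomorphic (G H : sgraph) : Prop :=
  exists2 f : G -> H, bijective f & forall x y, adj (f x) (f y) = adj x y.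

Definition contains_induced (G H : sgraph) : Prop :=
  exists S : {set G}, isomorphic (induced S) H.

Definition clique (G : sgraph) (K : {set G}) : bool :=
  [forall x in K, forall y in K, (x != y) ==> adj x y].

Definition omega (G : sgraph) : nat := \max_(K : {set G} | clique K) #|K|.

Definition colorable (G : sgraph) (k : nat) : bool :=
  [exists c : {ffun G -> 'I_k}, forall x, forall y, adj x y ==> (c x != c y)].

Lemma colorable_exists (G : sgraph) : exists k, colorable G k.
Proof.
exists #|G|; apply/existsP; exists [ffun x => enum_rank x].
apply/forallP=> x; apply/forallP=> y; apply/implyP=> xy.
rewrite !ffunE (inj_eq enum_rank_inj).
by apply: contraTneq xy => ->; rewrite adj_irrefl.
Qed.

Definition chi (G : sgraph) : nat := ex_minn (colorable_exists G).

Definition perfect (G : sgraph) : Prop :=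
  forall S : {set G}, chi (induced S) = omega (induced S).

Definition has_edge (G : sgraph) : Prop := exists x y : G, adj x y.

(* [finset.partition] would forbid empty parts, hence the explicit
   union and intersection. *)
Definition divisible (H : sgraph) : Prop :=
  exists A B : {set H},
    [/\ A :|: B = [set: H], A :&: B = set0,
        perfect (induced A) & omega (induced B) < omega H].

Definition perfectly_divisible (G : sgraph) : Prop :=
  forall S : {set G}, has_edge (induced S) -> divisible (induced S).

Section Paley17.
Local Open Scope ring_scope.

Definition paley17_adj : rel 'F_17 :=
  fun x y => (x != y) && [exists z : 'F_17, (z != 0) && (x - y == z ^+ 2)].

(* -1 = 4 ^ 2 in F_17. *)
Lemma paley17_adj_sym : symmetric paley17_adj.
Proof.
suff imp x y : paley17_adj x y -> paley17_adj y x.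
  by move=> x y; apply/idP/idP; apply: imp.
case/andP=> xy /existsP[z /andP[z0 /eqP xyz]].
rewrite /paley17_adj eq_sym xy /=; apply/existsP; exists (4%:R * z).
rewrite mulf_neq0 //= exprMn -xyz -opprB -mulN1r.
by apply/eqP; congr (_ * _); apply/val_inj.
Qed.

Lemma paley17_adj_irrefl : irreflexive paley17_adj.
Proof. by move=> x; rewrite /paley17_adj eqxx. Qed.

Definition P17 : sgraph := SGraph paley17_adj_sym paley17_adj_irrefl.
End Paley17.

(* Main.v *)
Require Import Defs.
From mathcomp Require Import all_boot all_order all_algebra.

Set Implicit Arguments.
Unset Strict Implicit.
Unset Printing Implicit Defensive.

Import GRing.Theory.

(** Write P for P(17). Both halves rest on its triangle-free vertex sets S, and on
    one kind of fact: a family F of vertex sets such that no triangle-free set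
    meets every member of F. Such a fact says that every triangle-free S misses
    some member of F.

    Chromatic bound. P has a partition into 6 independent sets, and the binomial
    is at least 6 as soon as omega(H) >= 3. If omega(H) <= 1, then H has no edge.
    There remains omega(H) = 2, where the bound is 3. Here F consists of the
    complements of certain unions of three independent triples: a triangle-free
    set misses one of them, hence lies in a 3-colourable union.

    Failure of divisibility. P has no clique of size 4. So if A and B partition P
    and omega(B) < omega(P), then B is triangle-free. With F a family of induced
    5-cycles of P, the set B misses one of these cycles, which then lies in A.
    An induced 5-cycle has clique number 2 and is not 2-colourable, so A is not
    perfect. The last claim follows since perfect divisibility passes to induced
    subgraphs.

    In both cases F is made of the images of one or two explicit patterns under
    the 136 maps x |-> q x + t with q a nonzero square, which are automorphisms
    of P. That no triangle-free set meets all of F is checked by a branching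
    search ([no_triangle_free_transversal]) whose soundness is
    [no_triangle_free_transversalP]. *)

(** * Clique number and chromatic number *)

(** Cliques are handled as sequences of pairwise adjacent vertices: irreflexivity
    makes them duplicate-free, and small ones can be written explicitly. *)
Lemma size_le_omega (G : sgraph) (s : seq G) :
  pairwise (@adj G) s -> size s <= omega G.
Proof.
move=> s_adj; have s_uniq : uniq s.
  rewrite uniq_pairwise; apply: sub_pairwise s_adj => x y.
  by apply: contraTneq => ->; rewrite adj_irrefl.
have clq : clique [set x in s].
  apply/forall_inP => x; rewrite inE => xs.
  apply/forall_inP => y; rewrite inE => ys.
  apply/implyP; elim: s s_adj xs ys {s_uniq} => //= z s IHs /andP[zs s_adj].
  rewrite !inE => /predU1P[->|xs] /predU1P[->|ys].
  - by rewrite eqxx.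
  - by move=> _; apply: (allP zs).
  - by move=> _; rewrite adj_sym; apply: (allP zs).
  - exact: IHs.
have := @leq_bigmax_cond _ (@clique G) (fun K : {set G} => #|K|) _ clq.
by rewrite cardsE (card_uniqP s_uniq).
Qed.

Lemma omega_le (G : sgraph) k :
  (forall s : seq G, pairwise (@adj G) s -> size s != k.+1) -> omega G <= k.
Proof.
move=> noclq; apply/bigmax_leqP => K /forall_inP clqK.
rewrite leqNgt; apply/negP => K_big.
have: size (take k.+1 (enum K)) == k.+1 by rewrite size_takel // -cardE.
apply/negP/noclq/(subseq_pairwise (take_subseq _ _)).
have /(sub_in_pairwise (P := mem K)) : {in mem K &, subrel (fun x y => x != y) (@adj G)}.
  by move=> x y xK yK; apply/implyP/(forall_inP (clqK x xK)).
apply; last by rewrite -uniq_pairwise enum_uniq.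
by apply/allP => x; rewrite mem_enum.
Qed.

Lemma colorable_nat (G : sgraph) k (c : G -> nat) :
  (forall x, c x < k) -> (forall x y, adj x y -> c x != c y) -> colorable G k.
Proof.
move=> c_lt c_adj; apply/existsP; exists [ffun x => Ordinal (c_lt x)].
by apply/forallP => x; apply/forallP => y; apply/implyP; rewrite !ffunE; apply: c_adj.
Qed.

Lemma chi_colorable (G : sgraph) : colorable G (chi G).
Proof. by rewrite /chi; case: ex_minnP. Qed.

Lemma chi_le (G : sgraph) k : colorable G k -> chi G <= k.
Proof. by move=> Gk; rewrite /chi; case: ex_minnP => m _; apply. Qed.

Lemma chi_edgeless (G : sgraph) : omega G <= 1 -> chi G <= omega G.
Proof.
move=> G1; apply/chi_le/(colorable_nat (c := fun=> 0)) => [x | x y xy].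
  by apply: (@size_le_omega G [:: x]).
by have := @size_le_omega G [:: x; y]; rewrite /= xy ltnNge G1 => /(_ isT).
Qed.

(** * Homomorphisms and induced subgraphs *)

Definition homomorphism (G H : sgraph) (f : G -> H) : Prop :=
  forall x y, adj x y -> adj (f x) (f y).

Lemma omega_homomorphism (G H : sgraph) (f : G -> H) :
  homomorphism f -> omega G <= omega H.
Proof.
move=> fE; apply: omega_le => s s_adj; rewrite neq_ltn ltnS; apply/orP; left.
rewrite -(size_map f) size_le_omega // pairwise_map.
by apply: sub_pairwise s_adj => x y; apply: fE.
Qed.

Lemma chi_homomorphism (G H : sgraph) (f : G -> H) :
  homomorphism f -> chi G <= chi H.
Proof.
move=> fE; apply: chi_le; have /existsP[c /forallP c_adj] := chi_colorable H.
apply: (colorable_nat (c := fun x => c (f x))) => // x y /fE.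
exact/implyP/(forallP (c_adj (f x))).
Qed.

Definition embedding (G H : sgraph) (f : G -> H) : Prop :=
  injective f /\ forall x y, adj (f x) (f y) = adj x y.

Lemma embedding_comp (G H K : sgraph) (f : G -> H) (g : H -> K) :
  embedding f -> embedding g -> embedding (g \o f).
Proof.
by case=> fI fE [gI gE]; split=> [|x y]; [apply: inj_comp | rewrite /= gE fE].
Qed.

Lemma embedding_val (G : sgraph) (S : {set G}) :
  embedding (val : induced S -> G).
Proof. by split=> //; apply: val_inj. Qed.

Lemma isomorphic_sym (G H : sgraph) : isomorphic G H -> isomorphic H G.
Proof.
case=> f [g fK gK] fE; exists g; first by exists f.
by move=> x y; rewrite -fE !gK.
Qed.

Lemma isomorphic_embedding (G H : sgraph) :
  isomorphic G H -> exists f : G -> H, embedding f.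
Proof. by case=> f /bij_inj fI fE; exists f. Qed.

Lemma omega_isomorphic (G H : sgraph) : isomorphic G H -> omega G = omega H.
Proof.
move=> GH; have [f [_ fE]] := isomorphic_embedding GH.
have [g [_ gE]] := isomorphic_embedding (isomorphic_sym GH).
by apply/eqP; rewrite eqn_leq; apply/andP; split;
  [apply: (omega_homomorphism (f := f)) | apply: (omega_homomorphism (f := g))];
  move=> x y; rewrite ?fE ?gE.
Qed.

Lemma chi_isomorphic (G H : sgraph) : isomorphic G H -> chi G = chi H.
Proof.
move=> GH; have [f [_ fE]] := isomorphic_embedding GH.
have [g [_ gE]] := isomorphic_embedding (isomorphic_sym GH).
by apply/eqP; rewrite eqn_leq; apply/andP; split;
  [apply: (chi_homomorphism (f := f)) | apply: (chi_homomorphism (f := g))];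
  move=> x y; rewrite ?fE ?gE.
Qed.

Lemma isomorphic_induced_imset (G H : sgraph) (f : G -> H) (S : {set G}) :
  embedding f -> isomorphic (induced S) (induced (f @: S)).
Proof.
case=> fI fE.
pose g (x : induced S) : induced (f @: S) := Sub (f (val x)) (imset_f f (valP x)).
exists g; last by move=> x y; apply: fE.
apply: inj_card_bij => [x y /(congr1 val) /fI /val_inj // | ].
have cardE (K : sgraph) (T : {set K}) : #|induced T| = #|T|.
  by rewrite card_sig; apply: eq_card.
by rewrite !cardE (card_imset _ fI).
Qed.

Lemma isomorphic_induced_setT (G : sgraph) : isomorphic (induced [set: G]) G.
Proof.
exists val; last by [].
by exists (fun x => Sub x (in_setT x)) => x; rewrite ?SubK //; apply: val_inj.
Qed.

Lemma perfect_embedding (G H : sgraph) (f : G -> H) :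
  embedding f -> perfect H -> perfect G.
Proof.
move=> fE H_perfect S; have iso := isomorphic_induced_imset S fE.
by rewrite (chi_isomorphic iso) (omega_isomorphic iso).
Qed.

(** The images of the two parts of a division form a division, since the parts
    induce subgraphs isomorphic to those induced by their images. *)
Lemma divisible_isomorphic (G H : sgraph) :
  isomorphic G H -> divisible G -> divisible H.
Proof.
move=> GH; have [f [g fK gK] fadj] := GH.
have fE : embedding f by split=> //; apply: can_inj fK.
case=> A [B [AUB AIB A_perfect omegaB]]; exists (f @: A), (f @: B); split.
- rewrite -imsetU AUB; apply/setP => y.
  by rewrite inE -(gK y) imset_f.
- by rewrite -imsetI ?AIB ?imset0 // => x y _ _; case: fE => fI _; apply: fI.
- have [h hE] := isomorphic_embedding (isomorphic_sym (isomorphic_induced_imset A fE)).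
  exact: perfect_embedding hE A_perfect.
- by rewrite -(omega_isomorphic GH) -(omega_isomorphic (isomorphic_induced_imset B fE)).
Qed.

(** An induced subgraph of G is isomorphic to one of H, and divisibility is an
    isomorphism invariant. *)
Lemma perfectly_divisible_embedding (G H : sgraph) (f : G -> H) :
  embedding f -> perfectly_divisible H -> perfectly_divisible G.
Proof.
move=> fE H_div S [x [y xy]]; have iso := isomorphic_induced_imset S fE.
apply: divisible_isomorphic (isomorphic_sym iso) _; apply: H_div.
by have [g _ gE] := iso; exists (g x), (g y); rewrite gE.
Qed.

(** * Induced 5-cycles are imperfect *)

Definition pentagon (T : Type) (e : rel T) (p : seq T) : bool :=
  if p is [:: a; b; c; d; f] then
    [&& e a b, e b c, e c d, e d f, e f a,
        ~~ e a c, ~~ e b d, ~~ e c f, ~~ e d a & ~~ e f b]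
  else false.

Lemma pentagon_map (T U : Type) (h : T -> U) (e : rel T) (e' : rel U) (p : seq T) :
  (forall x y, e' (h x) (h y) = e x y) -> pentagon e' (map h p) = pentagon e p.
Proof. by move=> hE; case: p => [|a[|b[|c[|d[|f[|? ?]]]]]] //=; rewrite !hE. Qed.

(** The subgraph induced by a pentagon has no triangle, so perfection would make it
    2-colourable, which an odd cycle is not. *)
Lemma perfect_pentagon_free (G : sgraph) (p : seq G) :
  perfect G -> ~~ pentagon (@adj G) p.
Proof.
move=> G_perfect; apply/negP.
case: p => [|a[|b[|c[|d[|f[|? ?]]]]]] //.
case/and5P=> ab bc cd df /and5P[fa ac bd cf /andP[da fb]].
set p := [:: a; b; c; d; f]; pose C := induced [set x in p].
have: chi C <= 2.
  rewrite /C G_perfect; apply: omega_le => -[|x[|y[|z[|? ?]]]] //=.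
  (* Each of the 125 triples contains a repeated or a nonadjacent pair. *)
  have no_triangle : all (fun u => all (fun v => all (fun w =>
      ~~ [&& adj u v, adj u w & adj v w]) p) p) p.
    have nadj u v : ~~ adj u v -> adj u v = false /\ adj v u = false.
      by move/negPf => uv; rewrite (adj_sym v) uv.
    have [/nadj[ac' ca'] /nadj[bd' db']] := (ac, bd).
    have [/nadj[cf' fc'] /nadj[da' ad']] := (cf, da).
    have [fb' bf'] := nadj _ _ _ fb.
    by rewrite /= !adj_irrefl ac' ca' bd' db' cf' fc' da' ad' fb' bf' /= !andbF.
  rewrite !andbT => /andP[/andP[xy xz] yz].
  have inp (u : C) : val u \in p by have := valP u; rewrite inE.
  have := allP (allP (allP no_triangle _ (inp x)) _ (inp y)) _ (inp z).
  by move: xy xz yz; rewrite /= /induced_adj => -> -> ->.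
move=> chi2; have /existsP[k /forallP k_adj] := chi_colorable C.
have inC u : u \in p -> u \in [set x in p] by rewrite in_set.
(* Two colours are encoded as a boolean, which must change along each edge
   of the cycle. *)
have col u v (up : u \in p) (vp : v \in p) : adj u v ->
    (k (Sub u (inC u up)) == 0 :> nat) != (k (Sub v (inC v vp)) == 0 :> nat).
  have := forallP (k_adj (Sub u (inC u up))) (Sub v (inC v vp)).
  rewrite /= /induced_adj /= => /implyP /[apply].
  rewrite -val_eqE /=; move: (k _) (k _) => i j.
  have [] := (leq_trans (ltn_ord i) chi2, leq_trans (ltn_ord j) chi2).
  by move: (nat_of_ord i) (nat_of_ord j) => [|[|?]] [|[|?]].
have [ap bp] : a \in p /\ b \in p by rewrite !inE !eqxx !orbT.
have [cp dp] : c \in p /\ d \in p by rewrite !inE !eqxx !orbT.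
have fp : f \in p by rewrite !inE !eqxx !orbT.
move: (col _ _ ap bp ab) (col _ _ bp cp bc) (col _ _ cp dp cd).
move: (col _ _ dp fp df) (col _ _ fp ap fa).
by do 5!case: (_ == 0).
Qed.

(** * Triangle-free sets that meet every member of a family *)

(** Branch on whether a vertex v of the first set of F is in the transversal; c
    lists the vertices already accepted. If v is accepted, the sets that contain
    it are met and are dropped, and the vertices that would close a triangle with
    v and a vertex of c are removed from the others. If v is rejected, it is
    removed everywhere. A set that becomes empty can no longer be met. The
    conditionals, unlike the boolean connectives, let call-by-value evaluation
    stop early; n bounds the depth, and running out of it is a failure. *)
Fixpoint no_triangle_free_transversal (e : rel nat) (n : nat)
    (F : seq (seq nat)) (c : seq nat) : bool :=
  if [::] \in F then true else if n is n'.+1 then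
    let v := head 0 (head [::] F) in
    let closes u := e v u && has (fun w => e w v && e w u) c in
    if no_triangle_free_transversal e n'
         [seq [seq u <- T | ~~ closes u] | T <- F & v \notin T] (v :: c)
    then no_triangle_free_transversal e n' [seq [seq u <- T | u != v] | T <- F] c
    else false
  else false.

(** Following the branches dictated by S leads to an emptied set; the vertices
    removed on the way are all outside S, so the original set misses S. *)
Lemma no_triangle_free_transversalP (e : rel nat) n F c (S : pred nat) :
  no_triangle_free_transversal e n F c ->
  (forall x y z, S x -> S y -> S z -> ~~ [&& e x y, e x z & e y z]) ->
  all S c -> has (fun T => ~~ has S T) F.
Proof.
move=> search S_free.
have nil_missed G : [::] \in G -> has (fun T => ~~ has S T) G.
  by move=> G0; apply/hasP; exists [::].
elim: n F c search => [|n IHn] F c /=; case: ifP => [/nil_missed // | _] //.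
set v := head 0 _; case: ifP => // search_in search_out Sc.
have [Sv|Sv] := boolP (S v).
  have /hasP[_ /mapP[T + ->]] := IHn _ _ search_in (introT andP (conj Sv Sc)).
  rewrite mem_filter => /andP[_ FT] T_missed; apply/hasP; exists T => //.
  apply: contra T_missed => /hasP[u uT Su]; apply/hasP; exists u => //.
  rewrite mem_filter uT andbT; apply/andP=> -[vu /hasP[w wc /andP[wv wu]]].
  by have := S_free _ _ _ (allP Sc w wc) Sv Su; rewrite wv wu vu.
have /hasP[_ /mapP[T FT ->] T_missed] := IHn _ _ search_out Sc.
apply/hasP; exists T => //; apply: contra T_missed => /hasP[u uT Su].
apply/hasP; exists u => //; rewrite mem_filter uT andbT.
by apply: contraNneq Sv => <-.
Qed.

(** * The Paley graph on integer labels *)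

Definition squares17 := [:: 1; 2; 4; 8; 9; 13; 15; 16].

(** Adjacency in P17 quantifies over a finite type, which does not evaluate well.
    It is replaced by a test on natural numbers modulo 17, where 16 stands for
    -1. *)
Definition adj17 : rel nat := fun m n => (m + 16 * n) %% 17 \in squares17.

Definition pt (n : nat) : P17 := (n%:R : 'F_17)%R.

Lemma square17P (d : 'F_17) :
  [exists z : 'F_17, (z != 0%R) && (d == z ^+ 2)%R] = (val d \in squares17).
Proof.
apply/existsP/idP => [[z /andP[+ /eqP ->]] | ].
  by case: z => z; do 17?[case: z => [|z] //].
have root r : (r%:R != 0 :> 'F_17)%R -> val d = val (r%:R ^+ 2 : 'F_17)%R ->
    exists z : 'F_17, (z != 0%R) && (d == z ^+ 2)%R.
  by move=> r0 dE; exists (r%:R)%R; rewrite r0; apply/eqP/val_inj.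
(* Square roots of 1, 2, 4, 8, 9, 13, 15 and 16 modulo 17. *)
rewrite 8!inE => /or4P[| | |/or4P[| | |/orP[]]] /eqP dE;
  [exact: (root 1) | exact: (root 6) | exact: (root 2) | exact: (root 5)
  |exact: (root 3) | exact: (root 8) | exact: (root 7) | exact: (root 4)].
Qed.

Lemma adj_pt m n : adj (pt m) (pt n) = adj17 m n.
Proof.
have sub_pt : val (pt m - pt n : 'F_17)%R = (m + 16 * n) %% 17.
  rewrite -(val_Fp_nat (p := 17)) // natrD natrM.
  have -> : (16%:R = -1 :> 'F_17)%R by apply: val_inj.
  by rewrite mulN1r.
rewrite /adj17 -sub_pt -square17P /= /paley17_adj.
case: eqVneq => //= ->; rewrite subrr; apply/esym/negbTE/existsP => -[z].
by case/andP => z0; rewrite eq_sym sqrf_eq0 (negPf z0).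
Qed.

Lemma pt_val (x : P17) : pt (val x) = x.
Proof. exact: natr_Zp. Qed.

(** * Two families without triangle-free transversal *)

(** Multiplication by a square and translation preserve adjacency, so a single
    pattern yields a whole family of induced copies of itself. *)
Definition affine_maps17 : seq (nat -> nat) :=
  [seq (fun x => (q * x + t) %% 17) | q <- squares17, t <- iota 0 17].

Definition pentagons17 : seq (seq nat) :=
  [seq map h [:: 0; 1; 3; 11; 13] | h <- affine_maps17].

Lemma pentagons17P : all (pentagon adj17) pentagons17.
Proof. by vm_compute. Qed.

Definition independent17 (I : seq nat) : bool :=
  all (fun m => all (fun n => ~~ adj17 m n) I) I.

(** Two patterns, because the images of neither one alone cover every
    triangle-free set by a union of their classes. *)
Definition tripartitions17 : seq (seq (seq nat)) :=
  [seq map (map h) cls |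
    cls <- [:: [:: [:: 0; 3; 6]; [:: 1; 8; 13]; [:: 2; 5; 12]];
               [:: [:: 0; 5; 11]; [:: 1; 7; 12]; [:: 2; 8; 14]]],
    h <- affine_maps17].

Lemma tripartitions17P : all (all independent17) tripartitions17.
Proof. by vm_compute. Qed.

(** Depth 17 suffices, since each branching decides one more vertex. *)
Lemma pentagons_no_triangle_free_transversal :
  no_triangle_free_transversal adj17 17 pentagons17 [::].
Proof. by vm_compute. Qed.

Definition uncovered17 (cls : seq (seq nat)) : seq nat :=
  [seq n <- iota 0 17 | n \notin flatten cls].

Lemma uncovered_no_triangle_free_transversal :
  no_triangle_free_transversal adj17 17 (map uncovered17 tripartitions17) [::].
Proof. by vm_compute. Qed.

(** * Cliques and colourings of the Paley graph *)

Fixpoint clique_free (e : rel nat) (k : nat) (V : seq nat) : bool :=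
  if k is k'.+1 then all (fun v => clique_free e k' [seq u <- V | e v u]) V
  else false.

Lemma clique_freeP (e : rel nat) (k : nat) (V s : seq nat) :
  clique_free e k V -> {subset s <= V} -> pairwise e s -> size s != k.
Proof.
elim: k V s => [|k IHk] V s //= V_free; case: s => //= v s sV /andP[vs s_pairwise].
have vV : v \in V by rewrite sV ?mem_head.
rewrite eqSS; apply: IHk (allP V_free v vV) _ s_pairwise => u us.
by rewrite mem_filter (allP vs) // sV // inE us orbT.
Qed.

Lemma omega_P17 : omega P17 <= 3.
Proof.
apply: omega_le => s s_adj; rewrite -(size_map val).
apply: (@clique_freeP adj17 4 (iota 0 17)) => [|n /mapP[x _ ->] |].
- by vm_compute.
- by rewrite mem_iota /=; apply: ltn_ord.
- rewrite pairwise_map; apply: sub_pairwise s_adj => x y.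
  by rewrite /= -adj_pt !pt_val.
Qed.

Lemma colorable_cover17 (S : {set P17}) (cls : seq (seq nat)) :
  all independent17 cls -> (forall x, x \in S -> val x \in flatten cls) ->
  colorable (induced S) (size cls).
Proof.
move=> cls_indep S_cover.
pose c (x : induced S) := find (fun I : seq nat => val (val x) \in I) cls.
have cls_has (x : induced S) : has (fun I : seq nat => val (val x) \in I) cls.
  by apply/hasP; have /flattenP[I] := S_cover _ (valP x); exists I.
apply: (colorable_nat (c := c)) => [x | x y]; first by rewrite -has_find.
apply: contraTneq => cxy; have := nth_find [::] (cls_has x).
have := nth_find [::] (cls_has y); rewrite -!/(c _) -cxy => yI xI.
have cx : c x < size cls by rewrite -has_find.
have := allP (allP (allP cls_indep _ (mem_nth [::] cx)) _ xI) _ yI.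
by rewrite /= /induced_adj -adj_pt !pt_val.
Qed.

(** The search applied to the triangle-free predicate on labels cut out by S. *)
Lemma missed_transversal (S : {set P17}) (F : seq (seq nat)) :
  no_triangle_free_transversal adj17 17 F [::] -> omega (induced S) <= 2 ->
  exists2 T, T \in F & forall n, n \in T -> pt n \notin S.
Proof.
move=> search S2.
have /hasP[T FT T_missed] : has (fun T => ~~ has (fun n => pt n \in S) T) F.
  apply: no_triangle_free_transversalP search _ isT => a b c Sa Sb Sc.
  apply: contraL S2 => /and3P[ab ac bc]; rewrite -ltnNge.
  apply: (@size_le_omega (induced S) [:: Sub (pt a) Sa; Sub (pt b) Sb; Sub (pt c) Sc]).
  by rewrite /= /induced_adj /= -![paley17_adj _ _]/(@adj P17 _ _) !adj_pt ab ac bc.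
by exists T => // n nT; apply: contra T_missed => Sn; apply/hasP; exists n.
Qed.

(** S misses the complement of the union of three independent sets, so it lies in
    that union. *)
Lemma chi_triangle_free17 (S : {set P17}) :
  omega (induced S) <= 2 -> chi (induced S) <= 3.
Proof.
move=> /(missed_transversal uncovered_no_triangle_free_transversal).
case=> _ /mapP[cls cls_in ->] missed.
have /eqP <- : size cls == 3.
  by apply: (allP (_ : all (fun cls => size cls == 3) tripartitions17)); first vm_compute.
apply/chi_le/colorable_cover17 => [|x xS]; first exact: (allP tripartitions17P).
apply: contraLR xS => x_out; rewrite -(pt_val x) missed // mem_filter x_out.
by rewrite mem_iota; apply: ltn_ord.
Qed.

Lemma chi_P17 (S : {set P17}) : chi (induced S) <= 6.
Proof.
pose cls := [:: [:: 0; 3]; [:: 1; 4; 7]; [:: 2; 9; 12]; [:: 5; 10; 15];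
  [:: 6; 13; 16]; [:: 8; 11; 14]].
apply/chi_le/(@colorable_cover17 S cls) => [|x _]; first by vm_compute.
have /allP : all [in flatten cls] (iota 0 17) by vm_compute.
by apply; rewrite mem_iota; apply: ltn_ord.
Qed.

Lemma chi_le_binomial17 (S : {set P17}) :
  chi (induced S) <= 'C((omega (induced S)).+1, 2).
Proof.
have [S1|S1] := leqP (omega (induced S)) 1.
  apply: leq_trans (chi_edgeless S1) _.
  by case: (omega _) S1 => [|[|]].
have [S2|S2] := leqP (omega (induced S)) 2.
  apply: leq_trans (chi_triangle_free17 S2) _.
  by have /eqP -> : omega (induced S) == 2 by rewrite eqn_leq S2.
by apply: leq_trans (chi_P17 S) (leq_bin2l 2 (_ : 4 <= _)).
Qed.

(** * Perfect divisibility of the Paley graph *)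

Lemma not_divisible_P17 : ~ divisible P17.
Proof.
case=> A [B [AUB _ A_perfect omegaB]].
have [|p p_in missed] := @missed_transversal B _ pentagons_no_triangle_free_transversal.
  by rewrite -ltnS (leq_trans omegaB omega_P17).
have pA : all [in A] (map pt p).
  apply/allP => _ /mapP[n np ->]; have := in_setT (pt n).
  by rewrite -AUB inE (negPf (missed n np)) orbF.
have : pentagon (@adj P17) (map pt p).
  by rewrite (pentagon_map _ adj_pt) (allP pentagons17P).
(* The cycle is lifted to the induced subgraph on A. *)
have [q _ <-] : exists2 q : seq (induced A), True & map val q = map pt p.
  elim: (map pt p) pA => [_|x s IHs /= /andP[xA /IHs[q _ <-]]]; first by exists [::].
  by exists (Sub x xA :: q).
rewrite (pentagon_map (e := @adj (induced A))) //.
exact/negP/perfect_pentagon_free.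
Qed.

Lemma not_perfectly_divisible_P17 : ~ perfectly_divisible P17.
Proof.
move=> P17_div; apply: not_divisible_P17.
apply: divisible_isomorphic (isomorphic_induced_setT P17) _; apply: P17_div.
by exists (Sub (pt 1) (in_setT _)), (Sub (pt 0) (in_setT _)); apply: (adj_pt 1 0).
Qed.

Theorem theorem1p1 :
  [/\ forall S : {set P17},
        chi (induced S) <= 'C((omega (induced S)).+1, 2),
      ~ perfectly_divisible P17
    & forall G : sgraph, contains_induced G P17 -> ~ perfectly_divisible G].
Proof.
split=> [||G [S iso] G_div].
- exact: chi_le_binomial17.
- exact: not_perfectly_divisible_P17.
- have [f fE] := isomorphic_embedding (isomorphic_sym iso).
  apply: not_perfectly_divisible_P17.
  exact: perfectly_divisible_embedding (embedding_comp fE (embedding_val S)) G_div.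
Qed.
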